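(* For $\lambda_3$-almost every $p=(a,b,c)\in\mathcal E_3^{\mathrm{nd}}$, the orbit $T^k(p)$ converges as $k\to\infty$ to one of the three patterned fixed points $(1,-1,-1)$, $(-1,1,-1)$, $(-1,-1,1)$.
   Context: For nonconstant $x,y\in\mathbb R^3$, with means $\bar x,\bar y$, the Pearson correlation is $\operatorname{corr}(x,y)=\frac{\sum_k(x_k-\bar x)(y_k-\bar y)}{\sqrt{\sum_k(x_k-\bar x)^2\sum_k(y_k-\bar y)^2}}$. For a real $3\times3$ matrix $A$ with nonconstant rows $r_1,r_2,r_3$, the correlation map is $[C(A)]_{ij}=\operatorname{corr}(r_i,r_j)$. For real $a,b,c$ let $A(a,b,c)=\begin{pmatrix} 1 & a & b \\ a & 1 & c \\ b & c & 1 \end{pmatrix}$. Let $\mathcal E_3=\{(a,b,c)\in[-1,1]^3:1+2abc-a^2-b^2-c^2\ge0\}$, and let $\mathcal E_3^{\mathrm{nd}}$ be the set of $(a,b,c)\in\mathcal E_3$ such that all rows of $A(a,b,c)$ are nonconstant; one has $\mathcal E_3^{\mathrm{nd}}=\mathcal E_3\setminus\{(1,1,1)\}$. The map $T:\mathcal E_3^{\mathrm{nd}}\to\mathcal E_3^{\mathrm{nd}}$ is defined by $A(T(p))=C(A(p))$, and $T^k$ is its $k$-th iterate. $\lambda_3$ is three-dimensional Lebesgue measure in the coordinates $(a,b,c)$. *)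

(* Defs.v *)
From HB Require Import structures.
From mathcomp Require Import all_boot all_order all_algebra.
From mathcomp Require Import all_classical all_reals all_analysis.
From mathcomp Require Import ring lra.
Set Implicit Arguments.
Unset Strict Implicit.
Unset Printing Implicit Defensive.
Import Order.TTheory GRing.Theory Num.Theory.
Import numFieldNormedType.Exports.
Local Open Scope classical_set_scope.
Local Open Scope ring_scope.

Section correlation.
Context {R : realType}.
Implicit Types (x y : 'rV[R]_3) (A : 'M[R]_3) (p : R * R * R).

Definition nonconstant x : Prop := ~ exists t, forall k, x 0 k = t.

Definition mean x : R := (\sum_k x 0 k) / 3.

(* When x or y is constant the denominator vanishes and, as 0^-1 = 0, the
   value is 0; only nonconstant vectors are meaningful here. *)
Definition corr x y : R :=
  (\sum_k (x 0 k - mean x) * (y 0 k - mean y)) /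
  Num.sqrt ((\sum_k (x 0 k - mean x) ^+ 2) * (\sum_k (y 0 k - mean y) ^+ 2)).

Definition corr_map A : 'M[R]_3 := \matrix_(i, j) corr (row i A) (row j A).

Definition Amx p : 'M[R]_3 :=
  let: (a, b, c) := p in
  \matrix_(i, j) (nth [::] [:: [:: 1; a; b];
                              [:: a; 1; c];
                              [:: b; c; 1]] i)`_j.

Definition elliptope3 : set (R * R * R) :=
  [set p | let: (a, b, c) := p in
     [/\ -1 <= a <= 1, -1 <= b <= 1, -1 <= c <= 1 &
         0 <= 1 + 2 * a * b * c - a ^+ 2 - b ^+ 2 - c ^+ 2]].

Definition elliptope3_nd : set (R * R * R) :=
  [set p | elliptope3 p /\ forall i, nonconstant (row i (Amx p))].

(* Total on R^3, reading off the three off-diagonal entries of the correlation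
   matrix; Amx_Tmap and Tmap_nd below show that on elliptope3_nd it is the
   self-map characterized by Amx (Tmap p) = corr_map (Amx p). *)
Definition Tmap p : R * R * R :=
  (corr_map (Amx p) 0 1, corr_map (Amx p) 0 2,
   corr_map (Amx p) 1 2).

Let S x y : R := \sum_k (x 0 k - mean x) * (y 0 k - mean y).

Let corrE x y : corr x y = S x y / Num.sqrt (S x x * S y y).
Proof. by rewrite /corr; congr (_ / Num.sqrt (_ * _)). Qed.

Let sum3 (F : 'I_3 -> R) : \sum_k F k = F 0 + F 1 + F 2.
Proof.
rewrite !big_ord_recl big_ord0 addr0 addrA.
by congr (_ + F _ + F _); apply/val_inj.
Qed.

Let ord3 (P : 'I_3 -> Prop) : P 0 -> P 1 -> P 2 -> forall i, P i.
Proof.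
move=> P0 P1 P2 [[|[|[|//]]] Hi].
- by rewrite (_ : Ordinal Hi = 0)//; apply/val_inj.
- by rewrite (_ : Ordinal Hi = 1)//; apply/val_inj.
- by rewrite (_ : Ordinal Hi = 2)//; apply/val_inj.
Qed.

Let S_ge0 x : 0 <= S x x.
Proof. by apply: sumr_ge0 => k _; rewrite -expr2 sqr_ge0. Qed.

Let S_gt0 x : nonconstant x -> 0 < S x x.
Proof.
move=> ncx; rewrite lt_neqAle S_ge0 andbT eq_sym; apply/negP => /eqP S0.
apply: ncx; exists (mean x) => k; apply/eqP; rewrite -subr_eq0 -sqrf_eq0.
rewrite expr2; apply/eqP.
apply: (psumr_eq0P _ S0) => // i _; by rewrite -expr2 sqr_ge0.
Qed.

Let sqS x : Num.sqrt (S x x) ^+ 2 = S x x.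
Proof. exact: sqr_sqrtr. Qed.

Let corr_sq x y :
  corr x y = S x y / (Num.sqrt (S x x) * Num.sqrt (S y y)).
Proof. by rewrite corrE sqrtrM. Qed.

Let SC x y : S x y = S y x.
Proof. by apply: eq_bigr => k _; rewrite mulrC. Qed.

Let corrC x y : corr x y = corr y x.
Proof. by rewrite !corr_sq SC [X in _ / X]mulrC. Qed.

Let corr_id x : nonconstant x -> corr x x = 1.
Proof.
move=> /S_gt0 Sx; rewrite corr_sq -expr2 sqS divff//.
by rewrite gt_eqF.
Qed.

Let gram x y z :
  S x x * S y y * S z z + 2 * S x y * S x z * S y z
  - S x y ^+ 2 * S z z - S x z ^+ 2 * S y y - S y z ^+ 2 * S x x = 0.
Proof. by rewrite /S /mean !sum3; field. Qed.

Let cauchy x y : S x y ^+ 2 <= S x x * S y y.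
Proof.
rewrite /S !sum3; set a := x 0 0 - _; set b := x 0 1 - _; set c := x 0 2 - _.
set d := y 0 0 - _; set e := y 0 1 - _; set f := y 0 2 - _.
rewrite -subr_ge0 (_ : _ - _ =
  (a * e - b * d) ^+ 2 + (a * f - c * d) ^+ 2 + (b * f - c * e) ^+ 2);
  last by ring.
by rewrite !addr_ge0// sqr_ge0.
Qed.

Let corr_itv x y : nonconstant x -> nonconstant y -> -1 <= corr x y <= 1.
Proof.
move=> /S_gt0 Sx /S_gt0 Sy; rewrite -ler_norml corr_sq normrM normfV.
have P : 0 < Num.sqrt (S x x) * Num.sqrt (S y y) by rewrite mulr_gt0// sqrtr_gt0.
rewrite (gtr0_norm P) ler_pdivrMr// mul1r -[leRHS](gtr0_norm P).
by rewrite -ler_sqr ?nnegrE// !real_normK ?num_real// exprMn !sqS cauchy.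
Qed.

Let corr_gram x y z : nonconstant x -> nonconstant y -> nonconstant z ->
  1 + 2 * corr x y * corr x z * corr y z
  - corr x y ^+ 2 - corr x z ^+ 2 - corr y z ^+ 2 = 0.
Proof.
move=> /S_gt0 Sx /S_gt0 Sy /S_gt0 Sz; rewrite !corr_sq.
have G := gram x y z; rewrite -(sqS x) -(sqS y) -(sqS z) in G.
move: G Sx Sy Sz; rewrite -(sqrtr_gt0 (S x x)) -(sqrtr_gt0 (S y y)) -(sqrtr_gt0 (S z z)).
set u := Num.sqrt _; set v := Num.sqrt (S y y); set w := Num.sqrt (S z z).
move=> G u0 v0 w0.
transitivity (0 / (u * v * w) ^+ 2); last by rewrite mul0r.
by rewrite -G; field; rewrite !gt_eqF.
Qed.

Let corr_eq1 x y : nonconstant x -> nonconstant y -> corr x y = 1 ->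
  exists2 t, 0 < t & forall i j, y 0 i - y 0 j = t * (x 0 i - x 0 j).
Proof.
move=> /S_gt0 Sx /S_gt0 Sy; rewrite corr_sq.
have [u0 v0] : 0 < Num.sqrt (S x x) /\ 0 < Num.sqrt (S y y).
  by rewrite !sqrtr_gt0.
move: (sqS x) (sqS y) u0 v0; set u := Num.sqrt _; set v := Num.sqrt (S y y).
move=> uE vE u0 v0 H.
have {}H : S x y = u * v.
  by rewrite -[LHS](@divfK _ (u * v)) ?H ?mul1r// gt_eqF// mulr_gt0.
pose F k := (u * (y 0 k - mean y) - v * (x 0 k - mean x)) ^+ 2.
have F0 : \sum_k F k = 0.
  transitivity (u ^+ 2 * S y y + v ^+ 2 * S x x - 2 * u * v * S x y).
    by rewrite /F /S !sum3; ring.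
  by rewrite H -uE -vE; ring.
have {}F0 k : u * (y 0 k - mean y) = v * (x 0 k - mean x).
  apply/eqP; rewrite -subr_eq0 -sqrf_eq0; apply/eqP.
  by apply: (psumr_eq0P _ F0) => // i _; exact: sqr_ge0.
exists (v / u); first by rewrite divr_gt0.
move=> i j; apply: (@mulfI _ u); first by rewrite gt_eqF.
transitivity (u * (y 0 i - mean y) - u * (y 0 j - mean y)); first by ring.
by rewrite !F0; field; rewrite gt_eqF.
Qed.

Lemma elliptope3_ndE : elliptope3_nd = elliptope3 `\ (1, 1, 1).
Proof.
apply/seteqP; split => -[[a b] c] /=.
- move=> [Ep nc]; split=> // -[a1 b1 c1]; apply: (nc 0).
  by exists 1; apply: ord3; rewrite !mxE /=.
- move=> [Ep ne]; split=> //; have [/= _ _ _ D] := Ep.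
  apply: ord3 => -[t Ht]; apply: ne; move: (Ht 0) (Ht 1) (Ht 2);
    rewrite !mxE /= => H0 H1 H2.
  + have [a1 b1] : a = 1 /\ b = 1 by split; lra.
    move: D; rewrite a1 b1 => D.
    have : (c - 1) ^+ 2 <= 0 by lra.
    by rewrite exprn_even_le0//= subr_eq0 => /eqP ->.
  + have [a1 c1] : a = 1 /\ c = 1 by split; lra.
    move: D; rewrite a1 c1 => D.
    have : (b - 1) ^+ 2 <= 0 by lra.
    by rewrite exprn_even_le0//= subr_eq0 => /eqP ->.
  + have [b1 c1] : b = 1 /\ c = 1 by split; lra.
    move: D; rewrite b1 c1 => D.
    have : (a - 1) ^+ 2 <= 0 by lra.
    by rewrite exprn_even_le0//= subr_eq0 => /eqP ->.
Qed.

Lemma Amx_Tmap p : elliptope3_nd p -> Amx (Tmap p) = corr_map (Amx p).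
Proof.
move=> [_ nc]; apply/matrixP; apply: ord3; apply: ord3;
  rewrite !mxE /= ?corr_id//; exact: corrC.
Qed.

Lemma Tmap_nd p : elliptope3_nd p -> elliptope3_nd (Tmap p).
Proof.
move=> pnd; rewrite elliptope3_ndE; have [Ep nc] := pnd; split.
  rewrite /Tmap /= !mxE; split; try exact: corr_itv.
  by rewrite corr_gram.
rewrite /Tmap /= !mxE => -[e1 e2 _].
have [t t0 Ht] := corr_eq1 (nc 0) (nc 1) e1.
have [s s0 Hs] := corr_eq1 (nc 0) (nc 2) e2.
move: (Ht 0 1) (Hs 0 2) Ep nc => {e1 e2 Ht Hs pnd}.
case: p => -[a b] c; rewrite !mxE /= => Ha Hb [a1 b1 _ _] /(_ 0); apply.
have a_1 : a = 1 by nra.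
have b_1 : b = 1 by nra.
by exists 1; apply: ord3; rewrite !mxE /=.
Qed.

Let corrN x : nonconstant x -> corr x (- x) = -1.
Proof.
move=> /S_gt0 Sx; rewrite corrE.
have -> : S x (- x) = - S x x by rewrite /S /mean !sum3 !mxE; ring.
have -> : S (- x) (- x) = S x x by rewrite /S /mean !sum3 !mxE; ring.
by rewrite sqrtrM// -expr2 sqS mulNr divff// gt_eqF.
Qed.

Lemma patterned_nd :
  [/\ elliptope3_nd (1, -1, -1), elliptope3_nd (-1, 1, -1) &
      elliptope3_nd (-1, -1, 1)].
Proof.
by rewrite !elliptope3_ndE; split; (split; first by split; lra);
  case=> *; lra.
Qed.

Lemma patterned_fixed :
  [/\ Tmap (1, -1, -1) = (1, -1, -1), Tmap (-1, 1, -1) = (-1, 1, -1) &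
      Tmap (-1, -1, 1) = (-1, -1, 1)].
Proof.
have [[_ n1] [_ n2] [_ n3]] := patterned_nd.
have rowP3 (u v : 'rV[R]_3) : u 0 0 = v 0 0 -> u 0 1 = v 0 1 ->
    u 0 2 = v 0 2 -> u = v.
  by move=> e0 e1 e2; apply/rowP; apply: ord3.
split; rewrite /Tmap !mxE.
- have -> : row 1 (Amx (1, -1, -1)) = row 0 (Amx (1, -1, -1)).
    by apply: rowP3; rewrite !mxE /=.
  have -> : row 2 (Amx (1, -1, -1)) = - row 0 (Amx (1, -1, -1)).
    by apply: rowP3; rewrite !mxE /= ?opprK.
  by rewrite corr_id// corrN.
- have -> : row 1 (Amx (-1, 1, -1)) = - row 0 (Amx (-1, 1, -1)).
    by apply: rowP3; rewrite !mxE /= ?opprK.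
  have -> : row 2 (Amx (-1, 1, -1)) = row 0 (Amx (-1, 1, -1)).
    by apply: rowP3; rewrite !mxE /=.
  by rewrite (corrC (- _)) corr_id// corrN.
- have -> : row 2 (Amx (-1, -1, 1)) = row 1 (Amx (-1, -1, 1)).
    by apply: rowP3; rewrite !mxE /=.
  have -> : row 1 (Amx (-1, -1, 1)) = - row 0 (Amx (-1, -1, 1)).
    by apply: rowP3; rewrite !mxE /= ?opprK.
  rewrite corrN//; congr (_, _); apply: corr_id.
  by rewrite (_ : - _ = row 1 (Amx (-1, -1, 1)))//;
    apply: rowP3; rewrite !mxE /= ?opprK.
Qed.

Definition lambda3 :
    set (measurableTypeR R * measurableTypeR R * measurableTypeR R) -> \bar R :=
  ((@lebesgue_measure R \x @lebesgue_measure R) \x @lebesgue_measure R)%E.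

HB.instance Definition _ := Measure.on lambda3.

End correlation.

(* Main.v *)
Require Import Defs.
From mathcomp Require Import all_boot all_order all_algebra.
From mathcomp Require Import all_classical all_reals all_analysis.
From mathcomp Require Import measurable_realfun ring lra.
Import Order.TTheory GRing.Theory Num.Theory.
Import numFieldNormedType.Exports.
Local Open Scope classical_set_scope.
Local Open Scope ring_scope.

(** Write a = 1 - 2z, b = 1 - 2y, c = 1 - 2x.  Correlations do not change when a
constant is added to a row, so the rows of A(a,b,c) may be replaced by the
multiples (0,z,y), (z,0,x), (y,x,0) of their differences with (1,1,1).  Hence T
depends only on the ratios x : y : z, and in the half-gap coordinates
z' = (1 - a')/2 etc. it reads
  1 - 2z' = (xy - z(x+y+z)/2) / (N(x,z) N(y,z)),
  N(u,v)^2 = u^2 - uv + v^2,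
together with the two formulas obtained by permuting x, y, z ([Tmap_half]).
All six permutations of (a,b,c) commute with T.

Suppose that a is the strict maximum and, by symmetry, that z < y <= x.  This
ordering is preserved ([next_gap_order]), and the ratio z/y is a strict Lyapunov
function: [next_gap_ratio_step] gives z'/y' <= r (1 - (1-r)/8) whenever
z/y <= r < 1.  Along an orbit the factor only improves, so z/y, and with it z,
tends to 0 geometrically, i.e. a -> 1.  Moreover the determinant condition of
the elliptope implies (x+z-y)^2 <= 4xz, and this forces 1 - y' <= (8/3) z/y
([next_gap_near1_ratio]); as y' <= x' <= 1, both b and c tend to -1.

So each point with a unique largest coordinate is attracted to the patterned
point whose entry 1 sits at that coordinate.  The remaining points lie on the
planes a = b, a = c, b = c, which are Lebesgue-null. *)

(** * The correlation map in half-gap coordinates *)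

(** The squared length of u e1 - v e2 for unit vectors e1, e2 at an angle of 60
degrees.  Up to a common factor it is the variance of the row (0,u,v). *)
Definition hexsq {R : rcfType} (u v : R) := u ^+ 2 - u * v + v ^+ 2.
Definition hexnorm {R : rcfType} (u v : R) := Num.sqrt (hexsq u v).

(** Up to the same factor, the covariance of the rows (0,z,y) and (z,0,x). *)
Definition hexdot {R : rcfType} (x y z : R) := x * y - z * (x + y + z) / 2.

(** The value of (1 - a')/2, where a' is the correlation of the rows (0,z,y) and
(z,0,x). *)
Definition next_gap {R : rcfType} (x y z : R) :=
  (1 - hexdot x y z / (hexnorm x z * hexnorm y z)) / 2.

Lemma hexsq_ge {R : rcfType} (u v : R) : 3 / 4 * u ^+ 2 <= hexsq u v.
Proof.
rewrite -subr_ge0 (_ : _ - _ = (v - u / 2) ^+ 2) ?sqr_ge0//; rewrite /hexsq.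
by field.
Qed.

Lemma hexsq_ge0 {R : rcfType} (u v : R) : 0 <= hexsq u v.
Proof.
by apply: le_trans (hexsq_ge u v); rewrite mulr_ge0 ?sqr_ge0 ?divr_ge0.
Qed.

Lemma hexnorm_ge0 {R : rcfType} (u v : R) : 0 <= hexnorm u v.
Proof. exact: sqrtr_ge0. Qed.

Lemma hexnorm_sq {R : rcfType} (u v : R) : hexnorm u v ^+ 2 = hexsq u v.
Proof. by rewrite sqr_sqrtr// hexsq_ge0. Qed.

Lemma hexnormC {R : rcfType} (u v : R) : hexnorm u v = hexnorm v u.
Proof. by congr Num.sqrt; rewrite /hexsq; ring. Qed.

Lemma next_gapC {R : rcfType} (x y z : R) : next_gap x y z = next_gap y x z.
Proof.
rewrite /next_gap [hexnorm x z * _]mulrC; congr ((1 - _ / _) / 2).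
by rewrite /hexdot; ring.
Qed.

Lemma hexnorm_gt0 {R : rcfType} (u v : R) : 0 < u -> 0 < hexnorm u v.
Proof.
move=> u0; rewrite sqrtr_gt0; apply: lt_le_trans (hexsq_ge _ _).
by rewrite mulr_gt0 ?exprn_gt0 ?divr_gt0.
Qed.

Lemma hexnorm_le {R : rcfType} (u v : R) : 0 <= v <= u -> hexnorm u v <= u.
Proof.
move=> /andP[v0 vu]; have u0 : 0 <= u by exact: le_trans vu.
by rewrite -ler_sqr ?nnegrE ?hexnorm_ge0// hexnorm_sq /hexsq; nra.
Qed.

(** The Gram determinant of two vectors of a plane is the square of their
determinant; this trades differences of radicals for polynomials. *)
Lemma hexdot_gram {R : rcfType} (x y z : R) :
  hexsq x z * hexsq y z - hexdot x y z ^+ 2 = 3 / 4 * (z * (x + y - z)) ^+ 2.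
Proof. by rewrite /hexsq /hexdot; field. Qed.

(** * The ratio of the two smallest gaps *)

(** This is what the inequality z'/y' < z/y amounts to once the denominators are
cleared and the factor y - z is removed; the term z * x ^+ 3 is the margin.
Let n1, n2, n3 be the norms at (y,z), (x,z), (x,y).  The term
2 n1 n2 n3 (n2 + n3) is linear in n1 n2; the bound n1 n2 <= xy is used against
n3 ^+ 2, while the weaker n1 n2 <= x(y + z) cancels exactly the mixed term of
(n2 + n3) ^+ 2.  What is left is z times a polynomial that is visibly at least
x ^+ 3. *)
Lemma radical_bound {R : rcfType} (x y z : R) : 0 <= z <= y -> y <= x ->
  z * x ^+ 3 + 2 * hexnorm y z * hexnorm x z * hexnorm x y
    * (hexnorm x z + hexnorm x y) <=
  x * (y + z) * (hexnorm x z + hexnorm x y) ^+ 2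
  + (x * hexsq y z - y * z * (y + z)) * (y + z - x).
Proof.
move=> /andP[z0 zy] yx; have y0 := le_trans z0 zy; have x0 := le_trans y0 yx.
have n1y : hexnorm y z <= y by rewrite hexnorm_le// z0.
have n2x : hexnorm x z <= x by rewrite hexnorm_le// z0 (le_trans zy).
have := hexnorm_sq x z; have := hexnorm_sq x y.
have := hexnorm_ge0 x y; have := hexnorm_ge0 x z; have := hexnorm_ge0 y z.
move: n1y n2x; set n1 := hexnorm y z; set n2 := hexnorm x z.
set n3 := hexnorm x y => n1y n2x n1p n2p n3p n3E n2E.
have n12 : n1 * n2 <= x * y by rewrite mulrC ler_pM.
have q30 := hexsq_ge0 x y.
have A1 : 2 * n3 * n2 * (n1 * n2) <= 2 * n3 * n2 * (x * (y + z)).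
  by rewrite ler_wpM2l ?mulr_ge0//; nra.
have A2 : 2 * (n1 * n2) * hexsq x y <= 2 * (x * y) * hexsq x y.
  by rewrite ler_wpM2r// ler_wpM2l.
have A3 : x * (y + z) * (hexsq x z + hexsq x y)
    + (x * hexsq y z - y * z * (y + z)) * (y + z - x) - 2 * (x * y) * hexsq x y
  = z * (x ^+ 3 + (x - y) * ((x - z) ^+ 2 + 2 * y ^+ 2 + z ^+ 2)
         + y * (y - z) ^+ 2).
  by rewrite /hexsq; ring.
have A4 : 0 <= z * ((x - y) * ((x - z) ^+ 2 + 2 * y ^+ 2 + z ^+ 2)
         + y * (y - z) ^+ 2).
  rewrite mulr_ge0// addr_ge0// mulr_ge0// ?subr_ge0// ?sqr_ge0//.
  by have := sqr_ge0 (x - z); have := sqr_ge0 y; have := sqr_ge0 z; lra.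
have -> : 2 * n1 * n2 * n3 * (n2 + n3)
    = 2 * n3 * n2 * (n1 * n2) + 2 * (n1 * n2) * n3 ^+ 2 by ring.
have -> : x * (y + z) * (n2 + n3) ^+ 2
    = x * (y + z) * (n2 ^+ 2 + n3 ^+ 2) + 2 * n3 * n2 * (x * (y + z)) by ring.
rewrite n2E n3E; lra.
Qed.

(** Division by 8 y ^+ 2 gives z'/y' <= z/y - (1 - z/y) (z/y) / (8 y'), so the
ratio of the two smallest gaps decreases. *)
Lemma next_gap_ratio_contracts {R : rcfType} (x y z : R) :
  0 <= z < y -> y <= x ->
  (y - z) * z <= 8 * y * (z * next_gap x z y - y * next_gap x y z).
Proof.
move=> /andP[z0 zy] yx.
have y0 : 0 < y by lra.
have x0 : 0 < x by lra.
have zy' := ltW zy; have zx := le_trans zy' yx.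
have := @radical_bound _ x y z; rewrite z0 zy' => /(_ isT yx).
rewrite /next_gap [hexnorm z y]hexnormC.
have : hexnorm y z <= y by rewrite hexnorm_le// z0.
have : hexnorm x z <= x by rewrite hexnorm_le// z0.
have : hexnorm x y <= x by rewrite hexnorm_le// ltW.
have := hexnorm_gt0 _ z y0; have := hexnorm_gt0 _ z x0.
have := hexnorm_gt0 _ y x0.
have := hexnorm_sq x z; have := hexnorm_sq x y.
set n1 := hexnorm y z; set n2 := hexnorm x z; set n3 := hexnorm x y.
move=> n3E n2E n3p n2p n1p n3x n2x n1y rb.
set G := z * n2 * (n1 * n3 - hexdot x z y) - y * n3 * (n1 * n2 - hexdot x y z).
have -> : z * ((1 - hexdot x z y / (n3 * n1)) / 2)
    - y * ((1 - hexdot x y z / (n2 * n1)) / 2) = G / (2 * n1 * n2 * n3).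
  by rewrite /G; field; rewrite !gt_eqF.
(* Multiplying G by n2 + n3 makes the factor y - z appear, since
   n3 - n2 = (y - z) (y + z - x) / (n2 + n3). *)
have E : G * (2 * (n2 + n3)) = (y - z) *
     (x * (y + z) * (n2 + n3) ^+ 2
      + (x * hexsq y z - y * z * (y + z)) * (y + z - x)
      - 2 * n1 * n2 * n3 * (n2 + n3)).
  transitivity (2 * (y * hexdot x y z * n3 ^+ 2 - z * hexdot x z y * n2 ^+ 2
      + (y * hexdot x y z - z * hexdot x z y) * n2 * n3)
      - 2 * (y - z) * n1 * n2 * n3 * (n2 + n3)); first by rewrite /G; ring.
  transitivity ((y - z) * (x * (y + z) * (n2 ^+ 2 + n3 ^+ 2 + 2 * n2 * n3)
      + (x * hexsq y z - y * z * (y + z)) * (y + z - x))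
      - 2 * (y - z) * n1 * n2 * n3 * (n2 + n3)); last by ring.
  by rewrite n3E n2E /hexsq /hexdot; field.
have H : (y - z) * (z * x ^+ 3) <= G * (2 * (n2 + n3)).
  by rewrite E ler_wpM2l ?subr_ge0//; lra.
have yz0 : 0 <= (y - z) * z by rewrite mulr_ge0 ?subr_ge0.
have G0 : 0 <= G.
  rewrite -(@pmulr_lge0 _ (2 * (n2 + n3))); last by lra.
  by rewrite (le_trans _ H)// !mulr_ge0 ?subr_ge0 ?exprn_ge0// ltW.
have H2 : (y - z) * z * x ^+ 2 <= 4 * G.
  rewrite -(@ler_pM2r _ x)//; apply: le_trans (_ : G * (2 * (n2 + n3)) <= _).
    apply: le_trans H.
    by rewrite [leLHS](_ : _ = (y - z) * (z * x ^+ 3))//; ring.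
  rewrite (_ : 4 * G * x = G * (4 * x)); last by ring.
  by rewrite ler_wpM2l//; lra.
rewrite mulrA ler_pdivlMr; last by rewrite !mulr_gt0.
have n123 : n1 * n2 * n3 <= y * x * x.
  by rewrite !ler_pM// ?mulr_ge0// ltW.
have H3 : (y - z) * z * (2 * n1 * n2 * n3) <= (y - z) * z * (2 * (y * x * x)).
  by rewrite ler_wpM2l//; lra.
apply: (le_trans H3).
have H4 : 2 * y * ((y - z) * z * x ^+ 2) <= 2 * y * (4 * G).
  by rewrite ler_wpM2l// mulr_ge0// ltW.
rewrite (_ : 8 * y * G = 2 * y * (4 * G)); last by ring.
apply: le_trans H4.
by rewrite [leLHS](_ : _ = 2 * y * ((y - z) * z * x ^+ 2))//; ring.
Qed.

(** The order of the two larger gaps is preserved.  After clearing denominators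
both sides can be squared, and the difference of the squares is z (x - y) times
a polynomial that is nonnegative for z <= y <= x. *)
Lemma next_gap_order {R : rcfType} (x y z : R) : 0 <= z < y -> y <= x ->
  next_gap x z y <= next_gap y z x.
Proof.
move=> /andP[z0 zy] yx.
have y0 : 0 < y by lra.
have x0 : 0 < x by lra.
rewrite /next_gap ler_pM2r ?invr_gt0// lerD2l lerN2 [hexnorm z y]hexnormC.
rewrite [hexnorm z x]hexnormC [hexnorm y x]hexnormC.
have := hexnorm_gt0 _ z y0; have := hexnorm_gt0 _ z x0.
have := hexnorm_gt0 _ y x0.
have := hexnorm_sq x z; have := hexnorm_sq y z.
set n1 := hexnorm y z; set n2 := hexnorm x z; set n3 := hexnorm x y.
move=> n1E n2E n3p n2p n1p.
rewrite ler_pdivrMr ?mulr_gt0//.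
rewrite (_ : _ / _ * _ = hexdot x z y * n2 / n1); last first.
  by field; rewrite !gt_eqF.
rewrite ler_pdivlMr// -lerN2 -!mulNr.
have i1 : 0 <= - hexdot y z x by rewrite /hexdot; nra.
have [i2|i2] := ltP (- hexdot x z y) 0.
  apply: (@le_trans _ _ 0); first by rewrite nmulr_rle0// ltW.
  by rewrite mulr_ge0// ltW.
have n1p' := ltW n1p; have n2p' := ltW n2p.
rewrite -ler_sqr ?nnegrE; [|exact: mulr_ge0..].
rewrite !exprMn n1E n2E -subr_ge0.
have -> : (- hexdot y z x) ^+ 2 * hexsq y z
  - (- hexdot x z y) ^+ 2 * hexsq x z =
  3 / 4 * (z * (x - y) *
    ((y - z) * (x ^+ 3 + x * (y ^+ 2 + z ^+ 2) - z * y * (y - z))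
     + x ^+ 2 * (2 * y ^+ 2 - z * y + 2 * z ^+ 2))).
  by rewrite /hexdot /hexsq; field.
rewrite mulr_ge0 ?divr_ge0// !mulr_ge0 ?subr_ge0// addr_ge0//.
  apply: mulr_ge0; first by lra.
  have x0' := ltW x0.
  have : 0 <= x ^+ 3 + x * z ^+ 2.
    by rewrite addr_ge0 ?exprn_ge0// mulr_ge0 ?sqr_ge0.
  have : y * (z * (y - z)) <= y * (y * x).
    by rewrite ler_pM2l// ler_pM// ?subr_ge0; lra.
  lra.
by rewrite mulr_ge0 ?sqr_ge0//; nra.
Qed.

Lemma next_gap_gt0 {R : rcfType} (x y z : R) :
  0 <= z < y -> y <= x -> 0 < next_gap x z y.
Proof.
move=> /andP[z0 zy] yx.
have y0 : 0 < y by lra.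
have x0 : 0 < x by lra.
rewrite /next_gap divr_gt0// subr_gt0 [hexnorm z y]hexnormC.
have n1p := hexnorm_gt0 _ z y0; have n3p := hexnorm_gt0 _ y x0.
rewrite ltr_pdivrMr ?mulr_gt0// mul1r.
have [i0|i0] := ltP (hexdot x z y) 0; first by rewrite (lt_trans i0)// mulr_gt0.
have xzy : 0 < x + z - y.
  rewrite ltNge; apply/negP => xzy; move: i0; rewrite /hexdot.
  have [-> ->] : z = 0 /\ x = y by split; lra.
  by rewrite leNgt => /negP; apply; nra.
rewrite -ltr_sqr ?nnegrE ?mulr_ge0// ?ltW// exprMn !hexnorm_sq -subr_gt0.
rewrite [hexsq y z](_ : _ = hexsq z y); last by rewrite /hexsq; ring.
by rewrite hexdot_gram mulr_gt0 ?divr_gt0 ?exprn_gt0 ?mulr_gt0.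
Qed.

(** The correlation of the rows (0,z,y) and (y,x,0) is close to -1 as soon as
their Gram determinant, a multiple of (y (x + z - y)) ^+ 2, is small compared
with the product of the variances.  The last hypothesis says that the square
roots of x, y, z are the sides of a possibly degenerate triangle. *)
Lemma next_gap_near1 {R : rcfType} (x y z : R) :
  0 <= z -> 0 < y -> 2 * z <= y -> y <= x -> (x + z - y) ^+ 2 <= 4 * x * z ->
  x * (1 - next_gap x z y) <= 8 / 3 * z.
Proof.
move=> z0 y0 zy yx tr; have x0 : 0 < x by lra.
have := hexdot_gram x z y.
rewrite /next_gap [hexnorm z y]hexnormC.
rewrite [hexsq z y](_ : _ = hexsq y z); last by rewrite /hexsq; ring.
have := hexnorm_sq x y; have := hexnorm_sq y z.
have := hexsq_ge x y; have := hexsq_ge y z.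
have := hexnorm_gt0 _ z y0; have := hexnorm_gt0 _ y x0.
have : hexdot x z y <= 0 by rewrite /hexdot; nra.
set n1 := hexnorm y z; set n3 := hexnorm x y; set w := hexdot x z y.
move=> w0 n3p n1p q1 q3 n1E n3E gr.
set m := n3 * n1; have m0 : 0 < m by rewrite mulr_gt0.
have mE : m ^+ 2 - w ^+ 2 = 3 / 4 * (y * (x + z - y)) ^+ 2.
  by rewrite /m exprMn n1E n3E.
have m2 : 9 / 16 * (x ^+ 2 * y ^+ 2) <= m ^+ 2.
  rewrite /m exprMn n1E n3E.
  rewrite (_ : _ * _ = (3 / 4 * x ^+ 2) * (3 / 4 * y ^+ 2)); last by field.
  by apply: ler_pM q3 q1; rewrite mulr_ge0 ?sqr_ge0 ?divr_ge0.
have wm : 0 <= m + w.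
  have : w ^+ 2 <= m ^+ 2 by rewrite -subr_ge0 mE mulr_ge0 ?sqr_ge0 ?divr_ge0.
  by rewrite -sqrrN ler_sqr ?nnegrE; lra.
have B : (m + w) * m <= 3 * (y ^+ 2 * (x * z)).
  apply: (@le_trans _ _ (m ^+ 2 - w ^+ 2)); first by nra.
  rewrite mE exprMn.
  have : y ^+ 2 * (x + z - y) ^+ 2 <= y ^+ 2 * (4 * x * z).
    by rewrite ler_wpM2l ?sqr_ge0.
  lra.
rewrite (_ : x * _ = x * ((m + w) * m) / (2 * m ^+ 2)); last first.
  by field; rewrite gt_eqF.
rewrite ler_pdivrMr ?mulr_gt0 ?exprn_gt0//.
have C1 : x * ((m + w) * m) <= x * (3 * (y ^+ 2 * (x * z))) by rewrite ler_pM2l.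
have C2 : z * (9 / 16 * (x ^+ 2 * y ^+ 2)) <= z * m ^+ 2 by rewrite ler_wpM2l.
lra.
Qed.

(** The form in which the contraction is iterated: an upper bound r on the
ratio, rather than the ratio itself, is carried along the orbit. *)
Lemma next_gap_ratio_step {R : rcfType} (x y z r : R) :
  0 <= z <= r * y -> 0 <= r < 1 -> 0 < y <= x -> next_gap x z y <= 1 ->
  next_gap x y z <= r * (1 - (1 - r) / 8) * next_gap x z y.
Proof.
move=> /andP[z0 zr] /andP[r0 r1] /andP[y0 yx] Y1.
have zy : 0 <= z < y by rewrite z0 (le_lt_trans zr)// gtr_pMl.
have := next_gap_ratio_contracts _ _ _ zy yx; have := next_gap_gt0 _ _ _ zy yx.
move: Y1; set Y := next_gap x z y; set Z := next_gap x y z => Y1 Y0 con.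
have [v [v0 vr zE]] : exists v, [/\ 0 <= v, v <= r & z = v * y].
  exists (z / y); rewrite divfK ?gt_eqF// ler_pdivrMr// divr_ge0// ltW//.
have {}con : v * (1 - v) <= 8 * (v * Y - Z).
  rewrite -(@ler_pM2r _ (y ^+ 2)) ?exprn_gt0//.
  by move: con; rewrite zE; lra.
have vY : 0 <= v * (1 - v) * (1 - Y) by rewrite !mulr_ge0//; lra.
have rY : v * (1 - (1 - v) / 8) * Y <= r * (1 - (1 - r) / 8) * Y.
  by rewrite ler_pM2r// ler_pM//; lra.
lra.
Qed.

Lemma next_gap_near1_ratio {R : rcfType} (x y z r : R) :
  0 <= z <= r * y -> 0 < y <= x -> (x + z - y) ^+ 2 <= 4 * x * z ->
  0 <= next_gap x z y -> 1 - next_gap x z y <= 8 / 3 * r.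
Proof.
move=> /andP[z0 zr] /andP[y0 yx] tr Y0.
(* For r >= 1/2 the bound 8/3 * r already exceeds 1. *)
have [r2|r2] := leP (1 / 2) r; first by lra.
have y2 : 2 * z <= y.
  have : r * y <= 1 / 2 * y by rewrite ler_pM2r// ltW.
  lra.
have x0 : 0 < x by lra.
have r0 : 0 <= r by rewrite -(pmulr_lge0 _ y0) (le_trans z0).
rewrite -(ler_pM2l x0); apply: (le_trans (next_gap_near1 _ _ _ z0 y0 y2 yx tr)).
have : z <= r * x by apply: (le_trans zr); rewrite ler_wpM2l.
lra.
Qed.

(** * The correlation map on the elliptope *)

Lemma sum_ord3 {R : realType} (F : 'I_3 -> R) :
  \sum_k F k = F 0 + F 1 + F 2.
Proof.
rewrite !big_ord_recl big_ord0 addr0 addrA.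
by congr (_ + F _ + F _); apply/val_inj.
Qed.

Lemma corr_scaled {R : realType} (u v : 'rV[R]_3) (k i m n : R) : 0 < k ->
  0 <= m ->
  \sum_j (u 0 j - mean u) * (v 0 j - mean v) = k * i ->
  \sum_j (u 0 j - mean u) ^+ 2 = k * m ->
  \sum_j (v 0 j - mean v) ^+ 2 = k * n ->
  corr u v = i / (Num.sqrt m * Num.sqrt n).
Proof.
move=> k0 m0 Ei Em En; rewrite /corr Ei Em En.
rewrite mulrACA sqrtrM ?mulr_ge0 1?ltW// -expr2 sqrtr_sqr gtr0_norm// sqrtrM//.
by rewrite invfM mulrACA divff ?mul1r// gt_eqF.
Qed.

Lemma Tmap_half {R : realType} (x y z : R) :
  Tmap (1 - 2 * z, 1 - 2 * y, 1 - 2 * x) =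
  (1 - 2 * next_gap x y z, 1 - 2 * next_gap x z y, 1 - 2 * next_gap y z x).
Proof.
have next_gapE (u v w : R) :
    1 - 2 * next_gap u v w = hexdot u v w / (hexnorm u w * hexnorm v w).
  by rewrite /next_gap; set q := hexdot u v w / _; field.
(* 4 from the factor 2 in each row, 2/3 from centering three entries. *)
have k0 : 0 < 8 / 3 :> R by lra.
rewrite !next_gapE /Tmap /corr_map !mxE; congr (_, _, _).
- rewrite [hexnorm x z * _]mulrC.
  apply: (corr_scaled _ _ _ _ _ _ k0); rewrite ?hexsq_ge0//;
    by rewrite /mean !sum_ord3 !mxE /= /hexdot /hexsq; field.
- rewrite [hexnorm x y * _]mulrC [hexnorm z y]hexnormC.
  apply: (corr_scaled _ _ _ _ _ _ k0); rewrite ?hexsq_ge0//;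
    by rewrite /mean !sum_ord3 !mxE /= /hexdot /hexsq; field.
- rewrite [hexnorm y x * _]mulrC [hexnorm z x]hexnormC [hexnorm y x]hexnormC.
  apply: (corr_scaled _ _ _ _ _ _ k0); rewrite ?hexsq_ge0//;
    by rewrite /mean !sum_ord3 !mxE /= /hexdot /hexsq; field.
Qed.

Definition swap12 {R : realType} (p : R * R * R) := (p.1.2, p.1.1, p.2).
Definition swap23 {R : realType} (p : R * R * R) := (p.1.1, p.2, p.1.2).

Lemma half_coord {R : realType} (a : R) : a = 1 - 2 * ((1 - a) / 2).
Proof. by field. Qed.

Lemma Tmap_swap12 {R : realType} (p : R * R * R) :
  Tmap (swap12 p) = swap12 (Tmap p).
Proof.
case: p => -[a b] c; rewrite (_ : swap12 (a, b, c) = (b, a, c))//.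
rewrite [a]half_coord [b]half_coord [c]half_coord !Tmap_half /swap12 /swap23 /=.
by rewrite [next_gap ((1 - b) / 2) ((1 - a) / 2) _]next_gapC.
Qed.

Lemma Tmap_swap23 {R : realType} (p : R * R * R) :
  Tmap (swap23 p) = swap23 (Tmap p).
Proof.
case: p => -[a b] c; rewrite (_ : swap23 (a, b, c) = (a, c, b))//.
rewrite [a]half_coord [b]half_coord [c]half_coord !Tmap_half /swap12 /swap23 /=.
rewrite [next_gap ((1 - b) / 2) ((1 - c) / 2) _]next_gapC.
rewrite [next_gap ((1 - b) / 2) ((1 - a) / 2) _]next_gapC.
by rewrite [next_gap ((1 - c) / 2) ((1 - a) / 2) _]next_gapC.
Qed.

Lemma nd_swap12 {R : realType} (p : R * R * R) :
  elliptope3_nd p -> elliptope3_nd (swap12 p).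
Proof.
rewrite !elliptope3_ndE; case: p => -[a b] c [[/= Ha Hb Hc D] ne].
split; first by split=> //=; lra.
by case=> ? ? ?; apply: ne; congr (_, _, _).
Qed.

Lemma nd_swap23 {R : realType} (p : R * R * R) :
  elliptope3_nd p -> elliptope3_nd (swap23 p).
Proof.
rewrite !elliptope3_ndE; case: p => -[a b] c [[/= Ha Hb Hc D] ne].
split; first by split=> //=; lra.
by case=> ? ? ?; apply: ne; congr (_, _, _).
Qed.

Lemma iter_comm {T : Type} (f s : T -> T) : (forall p, f (s p) = s (f p)) ->
  forall k p, iter k f (s p) = s (iter k f p).
Proof. by move=> fs k p; elim: k => //= k ->; rewrite fs. Qed.

(** The bounds of the previous part, with the triangle condition read off from
the elliptope: its determinant is 4 (4xz - (x+z-y)^2 - 4xyz). *)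
Lemma Tmap_step {R : realType} (x y z r : R) :
  elliptope3_nd (1 - 2 * z, 1 - 2 * y, 1 - 2 * x) ->
  z <= r * y -> 0 <= r < 1 -> 0 < y <= x ->
  [/\ next_gap x z y <= next_gap y z x, 0 < next_gap x z y,
      next_gap x y z <= r * (1 - (1 - r) / 8) * next_gap x z y &
      1 - next_gap x z y <= 8 / 3 * r].
Proof.
move=> pnd zr r01 yx.
have := Tmap_nd pnd; rewrite Tmap_half => -[[_ Y01 _ _] _].
have [[z01 _ _ D] _] := pnd.
have z0 : 0 <= z by lra.
have zrP : 0 <= z <= r * y by rewrite z0.
have /andP[r0 r1] := r01; have /andP[y0 yx'] := yx.
have zy : 0 <= z < y by rewrite z0 (le_lt_trans zr)// gtr_pMl.
split.
- exact: next_gap_order.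
- exact: next_gap_gt0.
- by apply: next_gap_ratio_step => //; lra.
- apply: next_gap_near1_ratio zrP yx _ _; last by rewrite ltW// next_gap_gt0.
  have : 0 <= x * y * z by rewrite !mulr_ge0//; lra.
  by move: D; lra.
Qed.

(** * Convergence of orbits *)

Lemma Tmap_orbit {R : realType} (a b c : R) : elliptope3_nd (a, b, c) ->
  c <= b -> b < a ->
  iter k Tmap (a, b, c) @[k --> \oo] --> ((1, -1, -1) : R * R * R).
Proof.
move=> pnd cb ba.
have b1 : 0 < 1 - b by case: pnd => -[/= /andP[_ a1] _ _ _] _; lra.
pose r := (1 - a) / (1 - b).
have r0 : 0 <= r.
  by rewrite divr_ge0 ?(ltW b1)//; case: pnd => -[/= /andP[_ a1] _ _ _] _; lra.
have r1 : r < 1 by rewrite ltr_pdivrMr// mul1r; lra.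
(* Every later ratio is at most r, so each step contracts by at least q. *)
pose q := 1 - (1 - r) / 8.
have q0 : 0 <= q < 1 by rewrite /q; apply/andP; split; lra.
have /andP[q0' q1'] := q0.
have rate_le n : r * q ^+ n <= r by rewrite ler_piMr// exprn_ile1// ltW.
pose P n x y z := [/\ iter n Tmap (a, b, c) = (1 - 2 * z, 1 - 2 * y, 1 - 2 * x),
  0 < y <= x, z <= r * q ^+ n * y &
  elliptope3_nd (1 - 2 * z, 1 - 2 * y, 1 - 2 * x)].
have step n x y z : P n x y z ->
  [/\ P n.+1 (next_gap y z x) (next_gap x z y) (next_gap x y z) &
    1 - next_gap x z y <= 8 / 3 * (r * q ^+ n)].
  move=> [itE yx zr nd].
  have rn : 0 <= r * q ^+ n < 1.
    by rewrite mulr_ge0 ?exprn_ge0// (le_lt_trans (rate_le n)).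
  have [ord Y0 con near] := Tmap_step _ _ _ _ nd zr rn yx.
  split=> //; split.
  + by rewrite iterS itE Tmap_half.
  + by rewrite Y0.
  + apply: (le_trans con); rewrite ler_pM2r// exprS mulrCA mulrC.
    rewrite ler_wpM2r//; first by case/andP: rn.
    by rewrite /q; have := rate_le n; lra.
  + by rewrite -Tmap_half; exact: Tmap_nd.
have inv n : exists x y z, P n x y z.
  elim: n => [|n [x [y [z /step[Pn _]]]]]; last by do 3 eexists; exact: Pn.
  exists ((1 - c) / 2), ((1 - b) / 2), ((1 - a) / 2).
  split; rewrite -?half_coord//=; first by lra.
  rewrite expr0 mulr1 mulrA ler_pM2r ?invr_gt0//.
  by rewrite divfK// gt_eqF.
have bnd n : let p := iter n.+1 Tmap (a, b, c) in
    [/\ `|1 - p.1.1| <= 16 / 3 * (r * q ^+ n),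
        `|-1 - p.1.2| <= 16 / 3 * (r * q ^+ n) &
        `|-1 - p.2| <= 16 / 3 * (r * q ^+ n)].
  have [x [y [z Pn]]] := inv n; have [Pn1 near] := step _ _ _ _ Pn.
  have [-> /andP[Y0 YX] ZY [[Z01 Y01 X01 _] _]] := Pn1.
  have rn : 0 <= r * q ^+ n by rewrite mulr_ge0 ?exprn_ge0.
  have rq : r * q ^+ n.+1 <= r * q ^+ n.
    by rewrite ler_wpM2l// exprS ler_piMl ?exprn_ge0// ltW.
  have Y1 : next_gap x z y <= 1 by lra.
  have : r * q ^+ n.+1 * next_gap x z y <= r * q ^+ n.+1 * 1.
    by apply: ler_wpM2l => //; rewrite mulr_ge0 ?exprn_ge0.
  by move=> ?; split; rewrite ler_norml /fst /snd; lra.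
have cv0 : 16 / 3 * (r * q ^+ n) @[n --> \oo] --> (0 : R).
  rewrite -[0](mulr0 (16 / 3 * r)).
  under eq_fun do rewrite mulrA.
  by apply: cvgM; [exact: cvg_cst|apply: cvg_expr; rewrite ger0_norm].
have cvgb (u : R ^nat) (l : R) :
    (forall n, `|l - u n.+1| <= 16 / 3 * (r * q ^+ n)) ->
    u n @[n --> \oo] --> l.
  move=> ub; rewrite -cvg_shiftS; apply: cvg_zero; apply: norm_cvg0.
  apply: (squeeze_cvgr _ (cvg_cst 0) cv0); apply: nearW => n.
  by rewrite normr_ge0 /= distrC.
pose o k := iter k Tmap (a, b, c).
rewrite [X in X @ _](_ : _ = fun k => ((o k).1.1, (o k).1.2, (o k).2));
  last first.
  by apply/funext => k; rewrite /o; case: (iter k _ _) => -[].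
have h1 : (iter k Tmap (a, b, c)).1.1 @[k --> \oo] --> (1 : R).
  by apply: cvgb => n; have [] := bnd n.
have h2 : (iter k Tmap (a, b, c)).1.2 @[k --> \oo] --> (-1 : R).
  by apply: cvgb => n; have [] := bnd n.
have h3 : (iter k Tmap (a, b, c)).2 @[k --> \oo] --> (-1 : R).
  by apply: cvgb => n; have [] := bnd n.
exact: (cvg_pair (cvg_pair h1 h2) h3).
Qed.

Lemma swap12_continuous {R : realType} : continuous (@swap12 R).
Proof.
move=> [[a b] c].
have f1 : fst @ nbhs ((a, b), c) --> (a, b).
  exact: @cvg_fst _ _ _ _ (nbhs_filter c).
have f2 : snd @ nbhs ((a, b), c) --> c.
  exact: @cvg_snd _ _ _ _ (nbhs_filter (a, b)).
have g1 : x.1.1 @[x --> nbhs (a, b, c)] --> a.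
  by apply: cvg_comp f1 _; exact: cvg_fst.
have g2 : x.1.2 @[x --> nbhs (a, b, c)] --> b.
  by apply: cvg_comp f1 _; exact: cvg_snd.
exact: (cvg_pair (cvg_pair g2 g1) f2).
Qed.

Lemma swap23_continuous {R : realType} : continuous (@swap23 R).
Proof.
move=> [[a b] c].
have f1 : fst @ nbhs ((a, b), c) --> (a, b).
  exact: @cvg_fst _ _ _ _ (nbhs_filter c).
have f2 : snd @ nbhs ((a, b), c) --> c.
  exact: @cvg_snd _ _ _ _ (nbhs_filter (a, b)).
have g1 : x.1.1 @[x --> nbhs (a, b, c)] --> a.
  by apply: cvg_comp f1 _; exact: cvg_fst.
have g2 : x.1.2 @[x --> nbhs (a, b, c)] --> b.
  by apply: cvg_comp f1 _; exact: cvg_snd.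
exact: (cvg_pair (cvg_pair g1 f2) g2).
Qed.

Lemma conj_orbit_cvg {T : topologicalType} (f s : T -> T) (p l : T) :
  continuous s -> (forall q, s (s q) = q) -> (forall q, f (s q) = s (f q)) ->
  iter k f (s p) @[k --> \oo] --> l ->
  iter k f p @[k --> \oo] --> s l.
Proof.
move=> cs ss fs fl.
rewrite (_ : (fun k => iter k f p) = s \o (fun k => iter k f (s p))).
  by apply: cvg_comp fl _; exact: cs.
by apply/funext => k /=; rewrite iter_comm// ss.
Qed.

Lemma swap12K {R : realType} (p : R * R * R) : swap12 (swap12 p) = p.
Proof. by case: p => -[]. Qed.

Lemma swap23K {R : realType} (p : R * R * R) : swap23 (swap23 p) = p.
Proof. by case: p => -[]. Qed.

Lemma orbit_max1 {R : realType} (a b c : R) : elliptope3_nd (a, b, c) ->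
  b < a -> c < a ->
  iter k Tmap (a, b, c) @[k --> \oo] --> ((1, -1, -1) : R * R * R).
Proof.
move=> nd ba ca; have [cb|bc] := leP c b; first exact: Tmap_orbit.
apply: (@conj_orbit_cvg _ _ swap23 _ (1, -1, -1) swap23_continuous swap23K
  Tmap_swap23).
by apply: Tmap_orbit => //; [exact: nd_swap23 nd|exact: ltW].
Qed.

Lemma orbit_max2 {R : realType} (a b c : R) : elliptope3_nd (a, b, c) ->
  a < b -> c < b ->
  iter k Tmap (a, b, c) @[k --> \oo] --> ((-1, 1, -1) : R * R * R).
Proof.
move=> nd ab cb.
apply: (@conj_orbit_cvg _ _ swap12 _ (1, -1, -1) swap12_continuous swap12K
  Tmap_swap12).
by apply: orbit_max1 => //; exact: nd_swap12 nd.
Qed.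

Lemma orbit_max3 {R : realType} (a b c : R) : elliptope3_nd (a, b, c) ->
  a < c -> b < c ->
  iter k Tmap (a, b, c) @[k --> \oo] --> ((-1, -1, 1) : R * R * R).
Proof.
move=> nd ac bc.
apply: (@conj_orbit_cvg _ _ swap23 _ (-1, 1, -1) swap23_continuous swap23K
  Tmap_swap23).
by apply: orbit_max2 => //; exact: nd_swap23 nd.
Qed.

(** * The exceptional planes *)

Lemma product_measure_null_sections {d1 d2 : measure_display}
  {T1 : measurableType d1} {T2 : measurableType d2} {R : realType}
  (m1 : {measure set T1 -> \bar R})
  (m2 : {sigma_finite_measure set T2 -> \bar R})
  (A : set (T1 * T2)) :
  (forall x, m2 (xsection A x) = 0%E) -> (m1 \x m2)%E A = 0%E.
Proof. by move=> A0; apply: integral0_eq => x _ /=. Qed.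

Lemma measurable_coincidence {d : measure_display} {T : measurableType d}
  {R : realType} (f g : T -> measurableTypeR R) :
  measurable_fun setT f -> measurable_fun setT g ->
  measurable [set x | f x = g x].
Proof.
move=> mf mg; rewrite (_ : [set x | _] =
  setT `&` (fun x => f x == g x) @^-1` [set true]).
  exact: measurable_fun_eqr.
by rewrite setTI; apply/seteqP; split => x /= /eqP.
Qed.

Lemma lebesgue_diagonal_null {R : realType} :
  (@lebesgue_measure R \x @lebesgue_measure R)%E
    [set q : measurableTypeR R * measurableTypeR R | q.1 = q.2] = 0%E.
Proof.
apply: product_measure_null_sections => x.
rewrite (_ : xsection _ x = [set x]); first exact: lebesgue_measure_set1.
by apply/seteqP; split => y; rewrite /xsection/= inE/= => ->.
Qed.

Lemma coincidence_planes_null {R : realType} :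
 [/\ lambda3.-negligible [set p : R * R * R | p.1.1 = p.1.2],
      lambda3.-negligible [set p : R * R * R | p.1.1 = p.2] &
      lambda3.-negligible [set p : R * R * R | p.1.2 = p.2]].
Proof.
pose T := measurableTypeR R.
have m11 : measurable_fun setT (fun p : T * T * T => p.1.1).
  exact: measurableT_comp measurable_fst measurable_fst.
have m12 : measurable_fun setT (fun p : T * T * T => p.1.2).
  exact: measurableT_comp measurable_snd measurable_fst.
have m2 : measurable_fun setT (fun p : T * T * T => p.2).
  exact: measurable_snd.
split.
(* The plane p.1.1 = p.1.2 is a cylinder over a diagonal: its sections in the
   last coordinate are empty or full, so it is the base that has to be null. *)
- apply/negligibleP; first exact: measurable_coincidence m11 m12.
  rewrite (_ : [set _ | _] = [set q : T * T | q.1 = q.2] `*` setT); last first.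
    by apply/seteqP; split => -[[a b] c] //= [].
  rewrite [LHS]product_measure1E//; last first.
    exact: measurable_coincidence measurable_fst measurable_snd.
  by rewrite [X in (X * _)%E](@lebesgue_diagonal_null R) mul0e.
- apply/negligibleP; first exact: measurable_coincidence m11 m2.
  apply: product_measure_null_sections => -[a b].
  rewrite (_ : xsection _ _ = [set a]); first exact: lebesgue_measure_set1.
  by apply/seteqP; split => y; rewrite /xsection/= inE/= => ->.
- apply/negligibleP; first exact: measurable_coincidence m12 m2.
  apply: product_measure_null_sections => -[a b].
  rewrite (_ : xsection _ _ = [set b]); first exact: lebesgue_measure_set1.
  by apply/seteqP; split => y; rewrite /xsection/= inE/= => ->.
Qed.

Theorem corollary7 (R : realType) :
  {ae @lambda3 R, forall p : R * R * R, elliptope3_nd p ->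
    [\/ iter k Tmap p @[k --> \oo] --> ((1, -1, -1) : R * R * R),
        iter k Tmap p @[k --> \oo] --> ((-1, 1, -1) : R * R * R) |
        iter k Tmap p @[k --> \oo] --> ((-1, -1, 1) : R * R * R)]}.
Proof.
have [N12 N13 N23] := @coincidence_planes_null R.
apply: negligibleS (negligibleU N12 (negligibleU N13 N23)).
move=> [[a b] c] /= /not_implyP[nd nconv]; apply: contrapT => neq.
apply: nconv.
have [ab|ba|ab] := ltgtP a b; last by case: neq; left.
- have [ac|ca|bc] := ltgtP b c; last by case: neq; right; right.
  + by apply: Or33; apply: orbit_max3 => //; exact: lt_trans ac.
  + by apply: Or32; exact: orbit_max2.
- have [ac|ca|bc] := ltgtP a c; last by case: neq; right; left.
  + by apply: Or33; apply: orbit_max3 => //; exact: lt_trans ac.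
  + by apply: Or31; exact: orbit_max1.
Qed.
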